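(* Let $P(\zeta)=a\zeta\bar\zeta+b\bar\zeta+\bar b\zeta+c$, where $a,b,c\in\Gamma$ and $a,c\in\mathbb{R}$, be a Hermitian quadratic polynomial. Let $z\in\mathbb{C}'$ be a root of $P$, let $\{a_n\}_{n\ge0}$ be a continued fraction expansion of $z$ over $\Gamma$, $\{z_n\}_{n\ge0}$ the associated iteration sequence, and $\{p_n\}_{n\ge-1},\{q_n\}_{n\ge-1}$ the corresponding $\mathcal{Q}$-pair. Suppose that $|q_{n-1}|\le|q_n|$ for all $n\in\mathbb{N}$. Then at least one of the following holds: (i) there exists an increasing sequence $\{n_k\}$ in $\mathbb{N}$ such that $P(p_{n_k}/q_{n_k})=0$ for all $k$; (ii) $\{a_n\}$ is bounded. In particular, if $P$ has no root in $K$, then $\{a_n\}$ is bounded, and moreover, if $\sup_{n\in\mathbb{N}}|\delta_n|=M<\infty$, where $\{\delta_n\}_{n\ge0}$ is the corresponding sequence of relative errors, then a bound for $\{|a_n|\}$ can be given depending only on $a,b,c$ and $M$.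
   Context: Throughout, $\Gamma$ is a (fixed) discrete Euclidean subring of $\mathbb{C}$ containing $1$ and spanning $\mathbb{C}$, i.e. one of $\mathbb{Z}[i]$, $\mathbb{Z}[\sqrt{2}\,i]$, $\mathbb{Z}[\frac12(1+\sqrt3\,i)]$, $\mathbb{Z}[\frac12(1+\sqrt7\,i)]$, $\mathbb{Z}[\frac12(1+\sqrt{11}\,i)]$. $K\subset\mathbb{C}$ is its quotient field and $\mathbb{C}'=\mathbb{C}\setminus K$. $\mathbb{N}=\{1,2,\dots\}$. Continued fraction expansion: for $z\in\mathbb{C}'$, a continued fraction expansion of $z$ (over $\Gamma$) is a sequence $\{a_n\}_{n\ge0}$ in $\Gamma$ for which there is a sequence $\{z_n\}_{n\ge 0}$ in $\mathbb{C}$ (the iteration sequence) with $z_0=z$ and, for all $n\ge0$, $0<|z_n-a_n|<1$ and $z_{n+1}=(z_n-a_n)^{-1}$. No further rule for the choice of $a_n$ is imposed. The corresponding $\mathcal{Q}$-pair $\{p_n\}_{n\ge-1}$, $\{q_n\}_{n\ge-1}$ in $\Gamma$ is given by $p_{-1}=1$, $p_0=a_0$, $p_n=a_np_{n-1}+p_{n-2}$ and $q_{-1}=0$, $q_0=1$, $q_n=a_nq_{n-1}+q_{n-2}$ for $n\ge1$ (one has $q_n\neq0$ for all $n\ge0$). The sequence of relative errors is $\delta_n=q_n(q_nz-p_n)$, $n\ge0$. *)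

(* Defs.v *)
From HB Require Import structures.
From mathcomp Require Import all_boot all_order all_algebra.
From mathcomp Require Import complex.
From mathcomp Require Import boolp classical_sets reals constructive_ereal ereal.
Set Implicit Arguments.
Unset Strict Implicit.
Unset Printing Implicit Defensive.
Import Order.TTheory GRing.Theory Num.Theory.
Import ComplexField.

Local Open Scope classical_set_scope.
Local Open Scope ring_scope.
Local Open Scope complex_scope.

Section ContinuedFractions.
Variable R : realType.

(* The real-valued modulus; the generic norm of R[i] takes its values in R[i]. *)
Definition cabs (x : R[i]) : R := Normc.normc x.

(* Z[w]: the values at w of polynomials with integer coefficients. *)
Definition Zadjoin (w : R[i]) : set R[i] :=
  [set x | exists p : {poly int}, x = (map_poly intr p).[w]].

Definition euclidean_generators : seq R[i] :=
  [:: 'i%C;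
      (Num.sqrt 2)%:C * 'i%C;
      2^-1 * (1 + (Num.sqrt 3)%:C * 'i%C);
      2^-1 * (1 + (Num.sqrt 7)%:C * 'i%C);
      2^-1 * (1 + (Num.sqrt 11)%:C * 'i%C)].

(* These five rings are all the discrete subrings G of the complex plane
   that contain 1, span the plane over the reals, and are Euclidean. *)
Definition euclidean_subring (G : set R[i]) : Prop :=
  exists2 w, w \in euclidean_generators & G = Zadjoin w.

Definition quotient_field (G : set R[i]) : set R[i] :=
  [set x | exists u v, [/\ G u, G v, v != 0 & x = u / v]].

Definition iteration_sequence (z : R[i]) (s zs : nat -> R[i]) : Prop :=
  zs 0%N = z /\
  forall n, 0 < cabs (zs n - s n) < 1 /\ zs n.+1 = (zs n - s n)^-1.

Definition cf_expansion (G : set R[i]) (z : R[i]) (s : nat -> R[i]) : Prop :=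
  (forall n, G (s n)) /\ exists zs, iteration_sequence z s zs.

(* The Q-pair is indexed from -1: pshift s n is p_(n-1), qshift s n is q_(n-1). *)
Fixpoint pshift (s : nat -> R[i]) (n : nat) : R[i] :=
  match n with
  | 0 => 1
  | m.+1 => match m with
            | 0 => s 0%N
            | k.+1 => s m * pshift s m + pshift s k
            end
  end.

Fixpoint qshift (s : nat -> R[i]) (n : nat) : R[i] :=
  match n with
  | 0 => 0
  | m.+1 => match m with
            | 0 => 1
            | k.+1 => s m * qshift s m + qshift s k
            end
  end.

Definition cf_num (s : nat -> R[i]) (n : nat) : R[i] := pshift s n.+1.
Definition cf_den (s : nat -> R[i]) (n : nat) : R[i] := qshift s n.+1.

Definition relative_error (z : R[i]) (s : nat -> R[i]) (n : nat) : R[i] :=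
  cf_den s n * (cf_den s n * z - cf_num s n).

Definition hermitian_poly (a b c : R[i]) (x : R[i]) : R[i] :=
  a * x * conjc x + b * conjc x + conjc b * x + c.

Definition bounded_seq (s : nat -> R[i]) : Prop :=
  exists B : R, forall n, cabs (s n) <= B.

End ContinuedFractions.

(* Main.v *)
(* Put e_n = q_n z - p_n. The recursion gives e_(n-1) = - z_(n+1) e_n, and with
   the determinant identity and |q_(n-1)| <= |q_n| this yields
   |q_n e_n| <= 1 / (|z_(n+1)| - 1). Expanding P at p_n/q_n = z - e_n/q_n, where
   P(z) = 0, the element N = |q_n|^2 P(p_n/q_n) of Gamma satisfies
   |N| <= 2 |a z + b| |q_n e_n| + |a| |e_n|^2, and |a z + b| is bounded in terms
   of a, b, c alone. So a large z_(n+1) forces |N| < 1, hence N = 0 because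
   Gamma is discrete. If P has no root in K this bounds all |a_n|;
   otherwise either N vanishes infinitely often or the tail of
   the digits is bounded. *)
Require Import Defs.
From HB Require Import structures.
From mathcomp Require Import all_boot all_order all_algebra.
From mathcomp Require Import complex.
From mathcomp Require Import boolp classical_sets reals constructive_ereal ereal.
From mathcomp Require Import ring lra.
Set Implicit Arguments.
Unset Strict Implicit.
Unset Printing Implicit Defensive.
Import Order.TTheory GRing.Theory Num.Theory.

Local Open Scope classical_set_scope.
Local Open Scope ring_scope.
Local Open Scope complex_scope.

(** * Modulus and conjugation on the complex plane *)

Section Modulus.
Variable R : realType.
Implicit Types x y : R[i].

Lemma cabsM x y : cabs (x * y) = cabs x * cabs y.
Proof. exact: Normc.normcM. Qed.

Lemma cabsN x : cabs (- x) = cabs x.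
Proof. by case: x => u v; rewrite /cabs /= !sqrrN. Qed.

Lemma cabs_conjc x : cabs (conjc x) = cabs x.
Proof. by case: x => u v; rewrite /cabs /= sqrrN. Qed.

Lemma cabs_ge0 x : 0 <= cabs x.
Proof. by case: x => u v; exact: sqrtr_ge0. Qed.

Lemma cabs0 : cabs (0 : R[i]) = 0.
Proof. exact: Normc.normc0. Qed.

Lemma cabs1 : cabs (1 : R[i]) = 1.
Proof. exact: Normc.normc1. Qed.

Lemma cabs_eq0 x : cabs x = 0 -> x = 0.
Proof. exact: Normc.eq0_normc. Qed.

Lemma cabsD x y : cabs (x + y) <= cabs x + cabs y.
Proof. by rewrite -lecR rmorphD /=; exact: (ler_normD x y). Qed.

Lemma cabsB x y : cabs (x - y) <= cabs x + cabs y.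
Proof. by rewrite -(cabsN y); exact: cabsD. Qed.

Lemma sqr_cabs x : (cabs x ^+ 2)%:C = x * conjc x.
Proof. by rewrite rmorphXn /=; exact: (sqr_normc x). Qed.

Lemma conjcM x y : conjc (x * y) = conjc x * conjc y.
Proof. exact: rmorphM. Qed.

Lemma conjcD x y : conjc (x + y) = conjc x + conjc y.
Proof. exact: rmorphD. Qed.

Lemma conjcN x : conjc (- x) = - conjc x.
Proof. exact: rmorphN. Qed.

Lemma conjc_int (m : int) : conjc (m%:~R : R[i]) = m%:~R.
Proof. exact: rmorph_int. Qed.

Lemma conjc_numreal x : x \is Num.real -> conjc x = x.
Proof. by move/complex_realP => [k ->]; exact: conjc_real. Qed.

End Modulus.

(** * Integral structure, conjugation and discreteness of the five rings *)

Section DiscreteRing.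
Variable R : realType.
Implicit Types (w x y : R[i]) (t d m : int).

Lemma ZadjoinD w x y : Zadjoin w x -> Zadjoin w y -> Zadjoin w (x + y).
Proof. by move=> [p ->] [q ->]; exists (p + q); rewrite rmorphD hornerD. Qed.

Lemma ZadjoinM w x y : Zadjoin w x -> Zadjoin w y -> Zadjoin w (x * y).
Proof. by move=> [p ->] [q ->]; exists (p * q); rewrite rmorphM hornerM. Qed.

Lemma Zadjoin_int w m : Zadjoin w (m%:~R : R[i]).
Proof. by exists m%:P; rewrite map_polyC hornerC. Qed.

Lemma Zadjoin_gen w : Zadjoin w w.
Proof. by exists 'X; rewrite map_polyX hornerX. Qed.

(** Horner induction: the quadratic relation turns [(m + n w) w + k] into
    [(k - n d) + (m + n t) w]. *)
Lemma Zadjoin_quadratic w t d x :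
  w ^+ 2 = t%:~R * w - d%:~R -> Zadjoin w x ->
  exists m n, x = m%:~R + n%:~R * w.
Proof.
move=> hw [p ->]; elim/poly_ind: p => [|p k [m [n IH]]].
  by exists 0, 0; rewrite rmorph0 horner0 mul0r addr0.
exists (k - n * d), (m + n * t).
rewrite rmorphD rmorphM /= map_polyX map_polyC /= hornerMXaddC IH.
rewrite mulrDl -mulrA -expr2 hw !rmorphD !rmorphN !rmorphM /=; ring.
Qed.

(** Conjugation sends [w] to [t - w], the other root of its quadratic, hence [m + n w] to
    [(m + n t) - n w]. *)
Lemma Zadjoin_conjc w t d x :
  conjc w = t%:~R - w -> w ^+ 2 = t%:~R * w - d%:~R ->
  Zadjoin w x -> Zadjoin w (conjc x).
Proof.
move=> cw hw hx; have [m [n ->]] := Zadjoin_quadratic hw hx.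
rewrite conjcD conjcM !conjc_int cw.
have -> : m%:~R + n%:~R * (t%:~R - w) = (m + n * t)%:~R + (- n)%:~R * w :> R[i].
  rewrite rmorphD rmorphM rmorphN /=; ring.
apply: ZadjoinD; first exact: Zadjoin_int.
by apply: ZadjoinM; [exact: Zadjoin_int|exact: Zadjoin_gen].
Qed.

(* [x * conjc x] is the integer [m^2 + t m n + d n^2]. *)
Lemma Zadjoin_discrete w t d x :
  conjc w = t%:~R - w -> w ^+ 2 = t%:~R * w - d%:~R ->
  Zadjoin w x -> cabs x < 1 -> x = 0.
Proof.
move=> cw hw hx x1; have [m [n ex]] := Zadjoin_quadratic hw hx.
have e : (cabs x ^+ 2)%:C = (m ^+ 2 + t * m * n + d * n ^+ 2)%:~R :> R[i].
  rewrite sqr_cabs ex conjcD conjcM !conjc_int cw.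
  have -> : (m%:~R + n%:~R * w) * (m%:~R + n%:~R * (t%:~R - w)) =
    m%:~R ^+ 2 + t%:~R * m%:~R * n%:~R
    + n%:~R ^+ 2 * (t%:~R * w - w ^+ 2) :> R[i] by ring.
  rewrite hw !rmorphD !rmorphM /=; ring.
set k := (X in X%:~R) in e.
have {}e : cabs x ^+ 2 = k%:~R by apply: complexI; rewrite e rmorph_int.
have k0 : 0 <= k by rewrite -(ler0z R) -e sqr_ge0.
have k1 : k < 1.
  by rewrite -(ltrz1 R) -e expr_lt1// cabs_ge0.
have {}k0 : k = 0 by apply/eqP; rewrite eq_le k0 andbT -ltzD1 add0r.
by apply: cabs_eq0; apply/eqP; rewrite -sqrf_eq0 e k0.
Qed.

Lemma half_generator (r : R) (d : int) :
  0 <= r -> 1 + r = (4 * d)%:~R ->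
  let w := 2^-1 * (1 + (Num.sqrt r)%:C * 'i) : R[i] in
  conjc w = 1%:~R - w /\ w ^+ 2 = 1%:~R * w - d%:~R.
Proof.
move=> r0 rd w; have i2 := sqr_i R.
have sr : (Num.sqrt r)%:C ^+ 2 = r%:C :> R[i] by rewrite -rmorphXn sqr_sqrtr.
have ed : r%:C = 4 * d%:~R - 1 :> R[i].
  rewrite -[r](addKr 1) rd rmorphD rmorphN rmorph1 rmorph_int rmorphM /=; ring.
have two : (2 : R[i]) != 0 by rewrite pnatr_eq0.
have cw : conjc w = 2^-1 * (1 - (Num.sqrt r)%:C * 'i).
  rewrite /w conjcM conjcD conjcM conjc_inv conjc_nat conjc1 conjc_real.
  congr (_ * (_ + _)); rewrite -mulrN; congr (_ * _).
  by apply/eqP; rewrite eq_complex /= oppr0 !eqxx.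
split; first by rewrite cw /w; field.
have -> : w ^+ 2 = 2^-1 ^+ 2 *
   (1 + 2 * (Num.sqrt r)%:C * 'i + (Num.sqrt r)%:C ^+ 2 * 'i ^+ 2).
  by rewrite /w; ring.
by rewrite sr i2 ed /w; field.
Qed.

Lemma pure_generator (r : R) (d : int) :
  0 <= r -> r = d%:~R ->
  let w := (Num.sqrt r)%:C * 'i : R[i] in
  conjc w = 0%:~R - w /\ w ^+ 2 = 0%:~R * w - d%:~R.
Proof.
move=> r0 rd w; have i2 := sqr_i R.
split.
  rewrite /w conjcM conjc_real sub0r -mulrN; congr (_ * _).
  by apply/eqP; rewrite eq_complex /= oppr0 !eqxx.
rewrite mul0r sub0r /w exprMn i2 -rmorphXn sqr_sqrtr// rd rmorph_int; ring.
Qed.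

(** [t] and [d] are the trace and norm of [w]: trace 0 with norms 1, 2 for the two imaginary
    generators, trace 1 with norms 1, 2, 3 for the half-integral ones. *)
Lemma euclidean_generator_quadratic w : w \in euclidean_generators R ->
  exists t d, conjc w = t%:~R - w /\ w ^+ 2 = t%:~R * w - d%:~R.
Proof.
rewrite !inE => /orP[|/orP[|/orP[|/orP[]]]] /eqP ->.
- exists 0, 1; have := @pure_generator 1 1; rewrite sqrtr1 mul1r; exact.
- by exists 0, 2; apply: pure_generator.
- by exists 1, 1; apply: half_generator => //; ring.
- by exists 1, 2; apply: half_generator => //; ring.
- by exists 1, 3; apply: half_generator => //; ring.
Qed.

Variable G : set R[i].
Hypothesis hG : euclidean_subring G.

Lemma euclidean_subringD x y : G x -> G y -> G (x + y).
Proof. by case: hG => w _ ->; exact: ZadjoinD. Qed.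

Lemma euclidean_subringM x y : G x -> G y -> G (x * y).
Proof. by case: hG => w _ ->; exact: ZadjoinM. Qed.

Lemma euclidean_subring_int m : G m%:~R.
Proof. by case: hG => w _ ->; exact: Zadjoin_int. Qed.

Lemma euclidean_subring_conjc x : G x -> G (conjc x).
Proof.
case: hG => w /euclidean_generator_quadratic[t [d [cw hw]]] -> hx.
exact: Zadjoin_conjc cw hw hx.
Qed.

Lemma euclidean_subring_discrete x : G x -> cabs x < 1 -> x = 0.
Proof.
case: hG => w /euclidean_generator_quadratic[t [d [cw hw]]] ->.
exact: Zadjoin_discrete cw hw.
Qed.

Lemma qshift_in (s : nat -> R[i]) : (forall n, G (s n)) ->
  forall n : nat, G (qshift s n).
Proof.
move=> hs n; suff: G (qshift s n) /\ G (qshift s n.+1) by case.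
elim: n => [|n [h0 h1]].
  by split; [exact: (euclidean_subring_int 0)|exact: (euclidean_subring_int 1)].
by split=> //; apply: euclidean_subringD => //; apply: euclidean_subringM.
Qed.

Lemma pshift_in (s : nat -> R[i]) : (forall n, G (s n)) ->
  forall n : nat, G (pshift s n).
Proof.
move=> hs n; suff: G (pshift s n) /\ G (pshift s n.+1) by case.
elim: n => [|n [h0 h1]].
  by split; [exact: (euclidean_subring_int 1)|exact: (hs 0%N)].
by split=> //; apply: euclidean_subringD => //; apply: euclidean_subringM.
Qed.

End DiscreteRing.

(** * The homogenized Hermitian polynomial and its size near a root *)

Section HermitianForm.
Variable R : realType.
Variables a b c : R[i].
Implicit Types p q z e : R[i].

(** The homogenization |q|^2 P(p/q), free of division so that its values at elements of [G] stay in
    [G]. *)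
Definition hermitian_form p q : R[i] :=
  a * p * conjc p + b * q * conjc p + conjc b * p * conjc q + c * q * conjc q.

Lemma hermitian_form_div p q : q != 0 ->
  hermitian_form p q = hermitian_poly a b c (p / q) * (q * conjc q).
Proof.
move=> q0; rewrite /hermitian_poly conjcM conjc_inv.
have q1 : conjc q != 0 by rewrite conjc_eq0.
by rewrite /hermitian_form; field; rewrite q0.
Qed.

(** A single constant D that dominates |a| and also |a z + b| at every root z, so that the final
    bounds involve only the coefficients. *)
Definition hermitian_height : R := cabs a + cabs b + cabs c.

Hypothesis ra : a \is Num.real.

(* [a P(z) = |a z + b|^2 - |b|^2 + a c], so [|a z + b|] is constant on the roots. *)
Lemma cabs_root_slope z : hermitian_poly a b c z = 0 ->
  cabs (a * z + b) <= hermitian_height.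
Proof.
move=> hz; have ca := conjc_numreal ra.
have e : (a * z + b) * conjc (a * z + b) = b * conjc b - a * c.
  rewrite conjcD conjcM ca.
  have -> : (a * z + b) * (a * conjc z + conjc b) =
     a * hermitian_poly a b c z + b * conjc b - a * c
    by rewrite /hermitian_poly; ring.
  by rewrite hz mulr0 add0r.
have := cabsB (b * conjc b) (a * c); rewrite -e !cabsM !cabs_conjc => h.
have [[[a0 b0] c0] w0] := (cabs_ge0 a, cabs_ge0 b, cabs_ge0 c, cabs_ge0 (a * z + b)).
have D0 : 0 <= hermitian_height by rewrite !addr_ge0.
(* After squaring, it remains to compare |b|^2 + |a||c| with (|a| + |b| + |c|)^2. *)
rewrite -(@ler_pXn2r _ 2)// ?nnegrE// /hermitian_height.
have [[ab bc] ac] := (mulr_ge0 a0 b0, mulr_ge0 b0 c0, mulr_ge0 a0 c0).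
have [aa cc] := (sqr_ge0 (cabs a), sqr_ge0 (cabs c)).
lra.
Qed.

(** Taylor expansion at the root: the constant term |q|^2 P(z) vanishes, the two linear terms are
    conjugate with slope a z + b, and the quadratic term is a |e|^2. *)
Lemma cabs_hermitian_form z e q : hermitian_poly a b c z = 0 ->
  cabs (hermitian_form (q * z - e) q) <=
  2 * hermitian_height * (cabs q * cabs e) + hermitian_height * cabs e ^+ 2.
Proof.
move=> hz; have ca := conjc_numreal ra.
have -> : hermitian_form (q * z - e) q =
    a * e * conjc e
    - ((a * z + b) * q * conjc e + conjc ((a * z + b) * q) * e).
  rewrite !conjcM conjcD conjcM ca.
  transitivity (hermitian_poly a b c z * (q * conjc q) + (a * e * conjc e
    - ((a * z + b) * q * conjc e + (a * conjc z + conjc b) * conjc q * e))).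
    by rewrite /hermitian_form conjcD conjcN conjcM /hermitian_poly; ring.
  by rewrite hz mul0r add0r.
apply: le_trans (cabsB _ _) _; rewrite addrC.
apply: lerD; last first.
  rewrite !cabsM cabs_conjc -mulrA -expr2 ler_wpM2r ?sqr_ge0//.
  by rewrite /hermitian_height -addrA lerDl addr_ge0// cabs_ge0.
apply: le_trans (cabsD _ _) _; rewrite !cabsM !cabs_conjc !cabsM.
have h := ler_wpM2r (mulr_ge0 (cabs_ge0 q) (cabs_ge0 e)) (cabs_root_slope hz).
lra.
Qed.

End HermitianForm.

(** * Errors of the convergents and bounds on the digits *)

Section Iteration.
Variables (R : realType) (z : R[i]) (s zs : nat -> R[i]).
Hypothesis hs : iteration_sequence z s zs.

(** The index is shifted as in the Q-pair: [err n] is e_(n-1), and [err 0] equals -1. *)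
Let err n := qshift s n * z - pshift s n.

(** By induction e_(n+1) = a_(n+1) e_n + e_(n-1) = (a_(n+1) - z_(n+1)) e_n, and z_(n+2) is the
    inverse of z_(n+1) - a_(n+1). *)
Lemma cf_error_step n : err n = - zs n.+1 * err n.+1.
Proof.
case: hs => z0 hstep.
have ne k : zs k - s k != 0.
  by apply/eqP => e; have [] := hstep k; rewrite e cabs0 ltxx.
elim: n => [|n IH].
  rewrite /err /= (hstep 0%N).2 -z0 mul0r mul1r.
  by rewrite sub0r mulNr mulVf.
have -> : err n.+2 = s n.+1 * err n.+1 + err n by rewrite /err /=; ring.
rewrite IH (hstep n.+1).2; field; exact: ne.
Qed.

(** The terms in z cancel, leaving the determinant of consecutive convergents, whose sign flips at
    each step. *)
Lemma cf_determinant n :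
  cabs (qshift s n.+1 * err n - qshift s n * err n.+1) = 1.
Proof.
elim: n => [|n IH]; first by rewrite /err /= !mul0r mul1r sub0r subr0 cabsN cabs1.
by rewrite -cabsN -IH; congr cabs; rewrite /err /=; ring.
Qed.

Hypothesis qmono :
  forall n : nat, (0 < n)%N -> cabs (cf_den s n.-1) <= cabs (cf_den s n).

Lemma cabs_cf_den_ge1 n : 1 <= cabs (qshift s n.+1).
Proof.
elim: n => [|n IH]; first by rewrite [qshift s 1]/= cabs1.
exact: le_trans IH (qmono (ltn0Sn n)).
Qed.

Lemma cabs_cf_den_le n : cabs (qshift s n) <= cabs (qshift s n.+1).
Proof.
(* The pair q_(-1) = 0, q_0 = 1 lies outside the range of [qmono]. *)
case: n => [|n]; first by rewrite [qshift s 0]/= cabs0 cabs_ge0.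
exact: qmono (ltn0Sn n).
Qed.

(** With the error step, the determinant factors as |e_n| |q_n z_(n+1) + q_(n-1)| = 1; the second
    factor is at least |q_n| (|z_(n+1)| - 1). *)
Lemma relative_error_bound n :
  cabs (qshift s n.+1) * cabs (err n.+1) * (cabs (zs n.+1) - 1) <= 1.
Proof.
have := cf_determinant n; rewrite cf_error_step.
have -> : qshift s n.+1 * (- zs n.+1 * err n.+1) - qshift s n * err n.+1 =
  - (err n.+1 * (qshift s n.+1 * zs n.+1 + qshift s n)) by ring.
rewrite cabsN cabsM => det1; rewrite -[leRHS]det1.
rewrite [_ * cabs (err _)]mulrC -mulrA ler_wpM2l ?cabs_ge0//.
have := cabsB (qshift s n.+1 * zs n.+1 + qshift s n) (qshift s n).
rewrite addrK cabsM; have := cabs_cf_den_le n; lra.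
Qed.

Lemma cabs_iterate_digit n : cabs (s n) <= cabs (zs n) + 1.
Proof.
have := cabsB (zs n) (zs n - s n); rewrite subKr.
by have [_ /(_ n)[/andP[_ h] _]] := hs; lra.
Qed.

Variables (G : set R[i]) (a b c : R[i]).
Hypothesis hG : euclidean_subring G.
Hypotheses (ha : G a) (hb : G b) (hc : G c) (ra : a \is Num.real).
Hypothesis hz : hermitian_poly a b c z = 0.
Hypothesis sG : forall n, G (s n).

(** The threshold gives |q_n e_n| (3 D + 1) <= 1. Since |e_n|^2 <= |q_n e_n|, the form is at most 3
    D |q_n e_n| < 1, and discreteness makes it zero. *)
Lemma root_convergent n : 3 * hermitian_height a b c + 2 < cabs (zs n.+1) ->
  hermitian_poly a b c (cf_num s n / cf_den s n) = 0.
Proof.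
move=> hn; set p := cf_num s n; set q := cf_den s n.
have q1 : 1 <= cabs q := cabs_cf_den_ge1 n.
have q0 : q != 0.
  by apply/eqP => e; move: q1; rewrite e cabs0 ler10.
have Gp : G p by exact: (pshift_in hG sG n.+1).
have Gq : G q by exact: (qshift_in hG sG n.+1).
have GF : G (hermitian_form a b c p q).
  have GM := euclidean_subringM hG; have GC := euclidean_subring_conjc hG.
  by rewrite /hermitian_form; do ?apply: euclidean_subringD => //;
    apply: (GM) => //; try (apply: (GM) => //); exact: GC.
have F0 : hermitian_form a b c p q = 0.
  apply: (euclidean_subring_discrete hG) => //.
  have -> : p = q * z - err n.+1 by rewrite /err subKr.
  apply: le_lt_trans (cabs_hermitian_form ra _ _ hz) _.
  have := relative_error_bound n; rewrite -/(cf_den s n) -/q.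
  have e0 := cabs_ge0 (err n.+1).
  set x := cabs (err n.+1) in e0 *; set y := cabs q in q1 *.
  set D := hermitian_height a b c in hn *; set t := cabs _ in hn *.
  have D0 : 0 <= D by rewrite !addr_ge0// cabs_ge0.
  move=> hyx.
  have yx0 : 0 <= y * x by rewrite mulr_ge0// (le_trans ler01).
  have yx1 : y * x * (3 * D + 1) <= 1.
    by apply: le_trans hyx; rewrite ler_wpM2l//; lra.
  have xy : x <= y * x by rewrite ler_peMl.
  have xx : x ^+ 2 <= y * x.
    have x1 : x <= 1 by nra.
    by apply: le_trans xy; rewrite expr2 ler_piMr.
  have DD := ler_wpM2l D0 xx.
  (* Strictness comes from 3 D y x <= 1 - y x when y x > 0; when y x = 0 the whole estimate is
     zero. *)
  have [yx|yx] := eqVneq (y * x) 0.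
    by rewrite yx; rewrite yx in DD; lra.
  have : 0 < y * x by rewrite lt_neqAle eq_sym yx.
  lra.
have := hermitian_form_div a b c p q0; rewrite F0 => /esym/eqP.
by rewrite !mulf_eq0 conjc_eq0 (negPf q0) !orbF => /eqP.
Qed.

(* When [a = 0] and [b != 0] the zero set is a line through the point
   [- c / (2 conjc b)] of the quotient field. *)
Lemma leading_coef_neq0 : c \is Num.real ->
  (forall x, quotient_field G x -> hermitian_poly a b c x <> 0) -> a != 0.
Proof.
move=> rc nroot; apply/eqP => a0; have cc := conjc_numreal rc.
(* With a = b = 0 the polynomial is the constant c, which the root z forces to be 0; then 0 is a
   root in the quotient field. *)
have [b0|b0] := eqVneq b 0.
  have c0 : c = 0.
    by move: hz; rewrite /hermitian_poly a0 b0 conjc0 !mul0r !add0r.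
  apply: (nroot 0); last by rewrite /hermitian_poly a0 b0 c0 conjc0 !mul0r !addr0.
  exists 0, 1; split; rewrite ?mul0r ?oner_eq0//.
    exact: (euclidean_subring_int hG 0).
  exact: (euclidean_subring_int hG 1).
have cb0 : conjc b != 0 by rewrite conjc_eq0.
have two : (2 : R[i]) != 0 by rewrite pnatr_eq0.
apply: (nroot ((- 1) * c / (2 * conjc b))).
  exists ((-1) * c), (2 * conjc b); split=> //; last by rewrite mulf_neq0.
    by apply: (euclidean_subringM hG) => //; exact: (euclidean_subring_int hG (-1)).
  apply: (euclidean_subringM hG); first exact: (euclidean_subring_int hG 2).
  exact: (euclidean_subring_conjc hG).
rewrite /hermitian_poly a0 !conjcM conjcN conjc_inv conjcM conjcK.
rewrite conjc_nat conjc1 cc; field.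
by rewrite b0 cb0.
Qed.

(** An iterate z_(n+1) beyond 3 D + 2 would make p_n/q_n a root in the quotient field; the remaining
    1 comes from |a_n| <= |z_n| + 1. *)
Lemma digit_bound : c \is Num.real ->
  (forall x, quotient_field G x -> hermitian_poly a b c x <> 0) ->
  forall n, cabs (s n) <= 3 * hermitian_height a b c + 3.
Proof.
move=> rc nroot n; apply: le_trans (cabs_iterate_digit n) _.
case: n => [|n].
  (* No convergent precedes z_0 = z. Instead a is nonzero, so |a| >= 1 by discreteness and |z| <= |a
     z + b| + |b|. *)
  have a0 := leading_coef_neq0 rc nroot.
  have a1 : 1 <= cabs a.
    rewrite leNgt; apply/negP => /(euclidean_subring_discrete hG ha).
    exact/eqP.
  have := cabsB (a * z + b) b; rewrite addrK cabsM (proj1 hs).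
  have := cabs_root_slope ra hz; have := cabs_ge0 z.
  have := cabs_ge0 b; have := cabs_ge0 c.
  rewrite /hermitian_height; nra.
suff: ~~ (3 * hermitian_height a b c + 2 < cabs (zs n.+1)) by rewrite -leNgt; lra.
apply/negP => /root_convergent; apply: nroot.
exists (cf_num s n), (cf_den s n); split=> //.
- exact: (pshift_in hG sG).
- exact: (qshift_in hG sG).
- by apply/eqP => e; have := cabs_cf_den_ge1 n; rewrite -/(cf_den s n) e cabs0 ler10.
Qed.

End Iteration.

(** * Bounded tails and subsequences *)

Lemma bounded_seq_tail (R : realType) (s : nat -> R[i]) N B :
  (forall n, (N <= n)%N -> cabs (s n) <= B) -> bounded_seq s.
Proof.
(* The sum covers the finitely many early terms; adding |B| compensates for a possibly negative
   [B]. *)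
move=> h; exists (B + \sum_(i < N) cabs (s i) + `|B|) => n.
have S0 : 0 <= \sum_(i < N) cabs (s i) by apply: sumr_ge0 => i _; exact: cabs_ge0.
have [/h hn|hn] := leqP N n; first by have := normr_ge0 B; lra.
have : cabs (s n) <= \sum_(i < N) cabs (s i).
  by rewrite (bigD1 (Ordinal hn))//= lerDl sumr_ge0// => i _; exact: cabs_ge0.
have := ler_norm (- B); rewrite normrN; lra.
Qed.

Lemma infinitely_often_subseq (Q : nat -> Prop) :
  (forall N, exists n, (N < n)%N /\ Q n) ->
  exists nk : nat -> nat,
    [/\ forall k, (0 < nk k)%N,
        forall j k : nat, (j < k)%N -> (nk j < nk k)%N
      & forall k, Q (nk k)].
Proof.
(* [f] picks a later index satisfying [Q]; iterating at least once makes even the first term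
   positive and a witness of [Q]. *)
move=> /choice[f hf]; exists (fun k => iter k.+1 f 0%N).
have fS k : (iter k f 0 < iter k.+1 f 0)%N by rewrite iterS; case: (hf (iter k f 0%N)).
split=> [k|j k jk|k]; first exact: leq_ltn_trans (leq0n _) (fS k).
- have := @homo_ltn _ (fun k => iter k.+1 f 0%N) (fun x y => (x < y)%N).
  by apply=> //; exact: ltn_trans.
- by rewrite iterS; case: (hf (iter k f 0%N)).
Qed.

(** * The alternative for a given expansion and the uniform bound *)

Theorem corollary3p9 (R : realType) (G : set R[i]) (hG : euclidean_subring G)
    (a b c : R[i]) (ha : G a) (hb : G b) (hc : G c)
    (ra : a \is Num.real) (rc : c \is Num.real) :
  (forall (z : R[i]) (s zs : nat -> R[i]),
     ~ quotient_field G z ->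
     hermitian_poly a b c z = 0 ->
     cf_expansion G z s ->
     iteration_sequence z s zs ->
     (forall n : nat, (0 < n)%N -> cabs (cf_den s n.-1) <= cabs (cf_den s n)) ->
     ((exists nk : nat -> nat,
         [/\ forall k, (0 < nk k)%N,
             forall j k : nat, (j < k)%N -> (nk j < nk k)%N
           & forall k, hermitian_poly a b c
                         (cf_num s (nk k) / cf_den s (nk k)) = 0])
      \/ bounded_seq s)
     /\ ((forall x, quotient_field G x -> hermitian_poly a b c x <> 0) ->
         bounded_seq s))
  /\
  ((forall x, quotient_field G x -> hermitian_poly a b c x <> 0) ->
   forall M : R, exists B : R,
   forall (z : R[i]) (s zs : nat -> R[i]),
     ~ quotient_field G z ->
     hermitian_poly a b c z = 0 ->
     cf_expansion G z s ->
     iteration_sequence z s zs ->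
     (forall n : nat, (0 < n)%N -> cabs (cf_den s n.-1) <= cabs (cf_den s n)) ->
     ereal_sup [set (cabs (relative_error z s n))%:E | n in [set n | (0 < n)%N]]
       = M%:E ->
     forall n : nat, cabs (s n) <= B).
Proof.
split=> [z s zs _ hz [sG _] hs qmono|nroot M]; last first.
  exists (3 * hermitian_height a b c + 3) => z s zs _ hz [sG _] hs qmono _.
  exact: (digit_bound hs qmono hG ha hb hc ra hz sG rc nroot).
split=> [|nroot]; last first.
  exists (3 * hermitian_height a b c + 3).
  exact: (digit_bound hs qmono hG ha hb hc ra hz sG rc nroot).
have [io|/existsNP[N hN]] := pselect (forall N, exists n, (N < n)%N /\
    hermitian_poly a b c (cf_num s n / cf_den s n) = 0).
  by left; exact: infinitely_often_subseq io.
(* No convergent of index above N is a root. The digit a_(n+1) is controlled by p_n/q_n, so n > N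
   means digit index at least N + 2. *)
right; apply: (@bounded_seq_tail _ _ N.+2 (3 * hermitian_height a b c + 3)).
case=> // n; rewrite ltnS => Nn; apply: le_trans (cabs_iterate_digit hs _) _.
suff: ~~ (3 * hermitian_height a b c + 2 < cabs (zs n.+1)) by rewrite -leNgt; lra.
apply/negP => big; apply: hN; exists n; split=> //.
exact: (root_convergent hs qmono hG ha hb hc ra hz sG big).
Qed.
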